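(* Let $k\ge 1$ be an integer, let $\lambda_1,\dots,\lambda_k>0$, and let $\{M(t)\}_{t\ge0}$ be the generalized counting process (GCP) with rates $\lambda_1,\dots,\lambda_k$, with state probabilities $p(n,t)=\mathrm{Pr}\{M(t)=n\}$, $n\ge 0$, $t\ge0$. Then for all $n\ge 1$ and $t\ge 0$, $$p(n,t)=\frac{t}{n}\sum_{j=1}^{\min\{n,k\}}j\lambda_{j}\,p(n-j,t).$$
   Context: The generalized counting process (GCP) $\{M(t)\}_{t\ge0}$ with rates $\lambda_1,\dots,\lambda_k>0$ is the counting process performing jumps of sizes $1,\dots,k$ with rates $\lambda_1,\dots,\lambda_k$ respectively. Its state probabilities $p(n,t)=\mathrm{Pr}\{M(t)=n\}$ satisfy, with $\Lambda=\lambda_1+\dots+\lambda_k$, $$\frac{\mathrm{d}}{\mathrm{d}t}p(n,t)=-\Lambda p(n,t)+\sum_{j=1}^{\min\{n,k\}}\lambda_j p(n-j,t),\quad n\ge0,$$ with $p(0,0)=1$ and $p(n,0)=0$ for $n\ge1$. It is a compound Poisson process: $M(t)\overset{d}{=}\sum_{i=1}^{N(t)}X_i$, where $\{N(t)\}_{t\ge0}$ is a Poisson process with intensity $\Lambda$ independent of the iid sequence $\{X_i\}_{i\ge1}$ with $\mathrm{Pr}\{X_1=j\}=\lambda_j/\Lambda$, $j=1,\dots,k$. *)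

(* Defs.v *)
From HB Require Import structures.
From mathcomp Require Import all_boot all_order all_algebra.
From mathcomp Require Import all_classical all_reals all_analysis.

Set Implicit Arguments.
Unset Strict Implicit.
Unset Printing Implicit Defensive.

Import Order.TTheory GRing.Theory Num.Theory.
Import numFieldNormedType.Exports.

Local Open Scope classical_set_scope.
Local Open Scope ring_scope.

(* Taking B i = setT for some of the i gives the product rule for every
   subfamily. *)
Definition mutually_independent (d d' : measure_display) (T : measurableType d)
    (E : measurableType d') (R : realType) (P : probability T R) (m : nat)
    (X : 'I_m -> T -> E) : Prop :=
  forall B : 'I_m -> set E, (forall i, measurable (B i)) ->
    P (\bigcap_(i in [set: 'I_m]) (X i @^-1` B i)) =
    (\prod_(i < m) P (X i @^-1` B i))%E.

(* Processes are indexed by all of R, but only times t >= 0 are constrained. *)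
Record counting_process (d : measure_display) (T : measurableType d)
    (R : realType) (M : R -> T -> nat) : Prop := {
  cp_measurable : forall t, 0 <= t -> measurable_fun setT (M t) ;
  cp_nondecreasing : forall w s t, 0 <= s -> s <= t -> (M s w <= M t w)%N
}.

(* For a counting process and s <= t the subtraction does not truncate. *)
Definition increment (R : realType) (T : Type) (M : R -> T -> nat) (s t : R) :
  T -> nat := fun w => (M t w - M s w)%N.

Definition independent_increments (d : measure_display) (T : measurableType d)
    (R : realType) (P : probability T R) (M : R -> T -> nat) : Prop :=
  forall (m : nat) (s : nat -> R), 0 <= s 0%N ->
    (forall i, (i < m)%N -> s i <= s i.+1) ->
    mutually_independent P (fun i : 'I_m => increment M (s i) (s i.+1)).

Definition stationary_increments (d : measure_display) (T : measurableType d)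
    (R : realType) (P : probability T R) (M : R -> T -> nat) : Prop :=
  forall s t h : R, 0 <= s -> s <= t -> 0 <= h ->
    forall B : set nat, measurable B ->
      P (increment M (s + h) (t + h) @^-1` B) = P (increment M s t @^-1` B).

Definition state_prob (d : measure_display) (T : measurableType d)
    (R : realType) (P : probability T R) (M : R -> T -> nat) (n : nat) (t : R) :
  R := fine (P [set w | M t w = n]).

(* Jumps of size j = 1, ..., k occur at rate lambda j; the values of lambda
   outside 1, ..., k are irrelevant. *)
Record GCP (d : measure_display) (T : measurableType d) (R : realType)
    (P : probability T R) (k : nat) (lambda : nat -> R) (M : R -> T -> nat) :
  Prop := {
  gcp_counting : counting_process M ;
  gcp_start : P [set w | M 0 w = 0%N] = 1%E ;
  gcp_independent : independent_increments P M ;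
  gcp_stationary : stationary_increments P M ;
  gcp_jump : forall j, (1 <= j <= k)%N ->
    (fun h : R => state_prob P M j h - lambda j * h) =o_ ((0 : R)^'+) id ;
  gcp_no_larger_jump :
    (fun h : R => fine (P [set w | (k < M h w)%N])) =o_ ((0 : R)^'+) id
}.

(* Main.v *)
Require Import Defs.
From HB Require Import structures.
From mathcomp Require Import all_boot all_order all_algebra.
From mathcomp Require Import all_classical all_reals all_analysis.

Set Implicit Arguments.
Unset Strict Implicit.
Unset Printing Implicit Defensive.

Import Order.TTheory GRing.Theory Num.Theory.
Import numFieldNormedType.Exports.

Local Open Scope classical_set_scope.
Local Open Scope ring_scope.

(** The state probabilities of the process form a convolution semigroup, so the
    generating functions [G_t(x) = \sum_n p(n,t) x^n] satisfy
    [G_(s+t) = G_s * G_t]: an increment over [[s, s+t]] is independent of the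
    past and distributed like [M t] (state_prob_convolution).  In particular
    [G_t = H ^ m] with [H = G_(t/m)], for every [m > 0].

    For any power of a series, [H * (H ^ m)' = m * H' * H ^ m].  Reading off
    the coefficient of [x^n] gives an exact identity
    [\sum_(j <= n) (j+1) p(j+1,t) p(n-j,t/m)
       = m * \sum_(j <= n) (j+1) p(j+1,t/m) p(n-j,t)]
    (state_prob_discrete_recursion).  Now let [m] tend to infinity.  The
    infinitesimal description of the jumps says that [p(0,h)] tends to 1 and
    that [p(j,h) / h] tends to [lambda j] for [1 <= j <= k] and to 0 for
    [j > k], as [h] decreases to 0 (state_prob0_cvg, state_prob_ratio_cvg).
    Hence only the term [j = n] survives on the left, and the limit is
    [(n+1) p(n+1,t) = t * \sum_(j <= n) (j+1) lambda_(j+1) p(n-j,t)] with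
    [lambda_j = 0] for [j > k].

    This is the coefficient form of [G' = t * (\sum_j j lambda_j x^(j-1)) * G],
    that is of [G_t = exp (t * \sum_j lambda_j (x^j - 1))]; passing to the
    limit in the discrete identity reaches it without solving the
    differential equations of the state probabilities. *)

(** * One-sided limits at 0 *)

Lemma cvg_littleo_ratio (R : realType) (f : R -> R) (l : R) :
  (fun h : R => f h - l * h) =o_ ((0 : R)^'+) id ->
  f h / h @[h --> 0^'+] --> l.
Proof.
move=> /eqoP fl; apply/cvgrPdist_le => e e0.
near=> h.
have h0 : 0 < h by near: h; exact: nbhs_right_gt.
have -> : l - f h / h = - (f h - l * h) / h.
  by rewrite opprB mulrBl mulfK ?gt_eqF.
rewrite normrM normrN normfV ler_pdivrMr ?normr_gt0 ?gt_eqF//.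
by near: h; exact: fl.
Unshelve. all: by end_near. Qed.

Lemma cvg_ratio0 (R : realType) (f : R -> R) (l : R) :
  f h / h @[h --> 0^'+] --> l -> f h @[h --> 0^'+] --> 0.
Proof.
move=> fl.
have : f h / h * h @[h --> 0^'+] --> l * 0.
  apply: cvgM => //; exact: (cvg_at_right_filter cvg_id).
rewrite mulr0; apply: cvg_trans; apply: near_eq_cvg.
near=> h.
have h0 : 0 < h by near: h; exact: nbhs_right_gt.
by rewrite divfK// gt_eqF.
Unshelve. all: by end_near. Qed.

(** The limits along [t / m] that are needed when [[0, t]] is cut into [m]
    equal steps. *)
Lemma cvg_at_right0_divn (R : realType) (f : R -> R) (l t : R) : 0 < t ->
  f h @[h --> 0^'+] --> l -> f (t / m.+1%:R) @[m --> \oo] --> l.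
Proof.
move=> t0 /cvg_at_rightP; apply; split=> [m|]; first by rewrite divr_gt0.
by rewrite -[X in _ --> X](mulr0 t); apply: cvgMr; exact: cvg_harmonic.
Qed.

(** * The convolution semigroup of the state probabilities *)

Lemma probability_eq_on_sure_event (R : realType) (d : measure_display)
    (T : measurableType d) (P : probability T R) (S A B : set T) :
  measurable S -> measurable A -> measurable B -> P S = 1%E ->
  A `&` S = B `&` S -> P A = P B.
Proof.
move=> mS mA mB PS AB.
have restr C : measurable C -> P C = P (C `&` S).
  move=> mC.
  have -> : P C = (P (C `\` S) + P (C `&` S))%E := measureDI P mC mS.
  suff -> : P (C `\` S) = 0%E by rewrite add0e.
  apply: (subset_measure0 (B := ~` S)) => //; first exact: measurableD.
  - exact: measurableC.
  - by have := probability_setC P mS; rewrite PS subee.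
by rewrite (restr A)// (restr B)// AB.
Qed.

Section gcp.
Context {R : realType} {d : measure_display} {T : measurableType d}.
Context {P : probability T R} {k : nat} {lambda : nat -> R}.
Context {M : R -> T -> nat} (hM : GCP P k lambda M).

Let p := state_prob P M.

Lemma gcp_event_measurable (t : R) (B : set nat) :
  0 <= t -> measurable (M t @^-1` B).
Proof.
move=> t0; rewrite -[X in measurable X]setTI.
exact: (cp_measurable (gcp_counting hM) t0).
Qed.

Lemma increment_event_measurable (s t : R) (B : set nat) :
  0 <= s -> 0 <= t -> measurable (increment M s t @^-1` B).
Proof.
move=> s0 t0; rewrite -[X in measurable X]setTI.
have mM r : 0 <= r -> measurable_fun setT (M r).
  exact: (cp_measurable (gcp_counting hM)).
exact: (measurable_realfun.measurable_fun_subn (mM _ t0) (mM _ s0)).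
Qed.

(** The axioms on increments speak of [M t - M 0], which is [M t] only almost
    surely: [M] starts at 0 with probability one, not pointwise. *)
Lemma state_prob_increment (n : nat) (t : R) : 0 <= t ->
  p n t = fine (P (increment M 0 t @^-1` [set n])).
Proof.
move=> t0; rewrite /p /state_prob; congr fine.
apply: (probability_eq_on_sure_event (S := [set w | M 0 w = 0%N])).
- exact: (gcp_event_measurable [set 0%N] (lexx 0)).
- exact: (gcp_event_measurable [set n] t0).
- exact: increment_event_measurable.
- exact: (gcp_start hM).
- by apply/seteqP; split=> w [/= Mn M0]; split=> //=;
    move: Mn; rewrite /increment M0 subn0.
Qed.

Lemma state_prob_shift (n : nat) (s h : R) : 0 <= s -> 0 <= h ->
  p n h = fine (P (increment M s (s + h) @^-1` [set n])).
Proof.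
move=> s0 h0; rewrite state_prob_increment//; congr fine.
have := gcp_stationary hM (lexx 0) h0 s0 (B := [set n]).
by rewrite add0r addrC => ->.
Qed.

Lemma state_prob_start (n : nat) : p n 0 = (n == 0%N)%:R.
Proof.
rewrite state_prob_increment// /increment.
case: n => [|n] /=.
  rewrite (_ : _ @^-1` _ = setT) ?probability_setT//.
  by apply/seteqP; split=> w //= _; rewrite subnn.
rewrite (_ : _ @^-1` _ = set0) ?measure0//.
by apply/seteqP; split=> w //=; rewrite subnn.
Qed.

Lemma increments_independent2 (s h : R) (i j : nat) : 0 <= s -> 0 <= h ->
  P (increment M 0 s @^-1` [set i] `&` increment M s (s + h) @^-1` [set j]) =
  (P (increment M 0 s @^-1` [set i]) *
   P (increment M s (s + h) @^-1` [set j]))%E.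
Proof.
move=> s0 h0.
pose times := nth 0 [:: 0; s; s + h].
have times_mono a : (a < 2)%N -> times a <= times a.+1.
  by case: a => [|[|[]]]//= _; rewrite lerDl.
have /(_ (fun a : 'I_2 => [set nth 0%N [:: i; j] a])) :=
  gcp_independent hM (m := 2) (s := times) (lexx 0) times_mono.
rewrite !big_ord_recl big_ord0 mule1/=; move=> <-//.
congr (P _); apply/seteqP; split=> w /=.
  by move=> [Mi Mj] [[|[|[]]]//= a] _.
by move=> H; split; [exact: (H ord0)|exact: (H (lift ord0 ord0))].
Qed.

(** Split the event according to the value at the intermediate time [s]; since
    the paths are nondecreasing, the two increments add up without
    truncation. *)
Lemma state_prob_convolution (n : nat) (s h : R) : 0 <= s -> 0 <= h ->
  p n (s + h) = \sum_(j < n.+1) p j s * p (n - j)%N h.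
Proof.
move=> s0 h0.
pose E (j : 'I_n.+1) := increment M 0 s @^-1` [set nat_of_ord j] `&`
  increment M s (s + h) @^-1` [set (n - j)%N].
have sh0 : 0 <= s + h by exact: addr_ge0.
have mE j : measurable (E j).
  by apply: measurableI; exact: increment_event_measurable.
have tE : trivIset setT E.
  move=> i j _ _ [w [[/= wi _] [/= wj _]]].
  by apply/val_inj; rewrite /= -wi -wj.
rewrite state_prob_increment//.
have -> : increment M 0 (s + h) @^-1` [set n] = \big[setU/set0]_(j < n.+1) E j.
  rewrite -bigcup_mkord_ord.
  have M0s w : (M 0 w <= M s w)%N.
    exact: (cp_nondecreasing (gcp_counting hM)).
  have Mss w : (M s w <= M (s + h) w)%N.
    by apply: (cp_nondecreasing (gcp_counting hM)); rewrite ?lerDl.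
  apply/seteqP; split=> w /=; rewrite /increment.
    move=> Mn.
    have jn : (M s w - M 0 w < n.+1)%N by rewrite ltnS -Mn leq_sub2r.
    exists (M s w - M 0 w)%N => //=.
    rewrite /E/= /increment inordK//; split=> //.
    by rewrite -Mn subnBA// subnK// (leq_trans (M0s w)).
  move=> [j /= jn]; rewrite /E/= /increment inordK// => -[Mj Mnj].
  by rewrite -(subnKC (jn : (j <= n)%N)) -Mnj -Mj addnC addnBA// subnK.
rewrite measure_bigsetU_ord//= -sum_fine; last first.
  by move=> j _; exact: fin_num_measure.
apply: eq_bigr => j _; rewrite /E increments_independent2//.
rewrite fineM ?fin_num_measure//; [|exact: increment_event_measurable..].
by rewrite -state_prob_increment// -state_prob_shift.
Qed.

(** This is [G_(m h) = G_h ^ m].  Truncating [G_h] to a polynomial of degree [n]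
    is harmless because a coefficient of index [i <= n] of a product involves
    only coefficients of index at most [i]. *)
Lemma state_prob_mulrn (n m i : nat) (h : R) : 0 <= h -> (i <= n)%N ->
  ((\poly_(j < n.+1) p j h) ^+ m)`_i = p i (m%:R * h).
Proof.
move=> h0; elim: m i => [|m IHm] i le_in.
  by rewrite mul0r state_prob_start expr0 coef1.
rewrite exprSr coefM -natr1 mulrDl mul1r state_prob_convolution//; last first.
  by rewrite mulr_ge0.
apply: eq_bigr => j _.
rewrite IHm; last by rewrite (leq_trans _ le_in)// -ltnS.
by rewrite coef_poly ltnS (leq_trans (leq_subr _ _) le_in).
Qed.

(** The coefficient of [x^n] in [(H ^ m)' * H = m * H' * H ^ m], where [H] is the
    generating function at time [h] and [H ^ m] the one at time [m * h]. *)
Lemma state_prob_discrete_recursion (n m : nat) (h : R) : 0 <= h ->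
  \sum_(j < n.+1) p j.+1 (m%:R * h) *+ j.+1 * p (n - j)%N h =
  (\sum_(j < n.+1) p j.+1 h *+ j.+1 * p (n - j)%N (m%:R * h)) *+ m.
Proof.
move=> h0; (* Derivatives shift indices by one, hence a truncation at degree n.+1. *)
pose q : {poly R} := \poly_(j < n.+2) p j h.
have qE m' i : (i <= n.+1)%N -> (q ^+ m')`_i = p i (m'%:R * h).
  exact: state_prob_mulrn.
have q1 i : (i <= n.+1)%N -> q`_i = p i h.
  by move=> le_i; rewrite coef_poly ltnS le_i.
have dq : (q ^+ m)^`() * q = q^`() * q ^+ m *+ m.
  rewrite deriv_exp; case: (m) => [|m']; first by rewrite !mulr0n mul0r.
  by rewrite mulrnAl -mulrA -exprSr.
have -> : \sum_(j < n.+1) p j.+1 (m%:R * h) *+ j.+1 * p (n - j)%N h =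
    ((q ^+ m)^`() * q)`_n.
  rewrite coefM; apply: eq_bigr => j _; rewrite coef_deriv qE// q1//.
  by rewrite (leq_trans (leq_subr _ _)).
have -> : \sum_(j < n.+1) p j.+1 h *+ j.+1 * p (n - j)%N (m%:R * h) =
    (q^`() * q ^+ m)`_n.
  rewrite coefM; apply: eq_bigr => j _; rewrite coef_deriv q1// qE//.
  by rewrite (leq_trans (leq_subr _ _)).
by rewrite -coefMn dq.
Qed.


(** * Behaviour at small times *)

Lemma state_prob_ge0 (n : nat) (t : R) : 0 <= p n t.
Proof. exact: fine_ge0. Qed.

Let tail (h : R) : R := fine (P [set w | (k < M h w)%N]).

Lemma tail_ratio_cvg : tail h / h @[h --> 0^'+] --> (0 : R).
Proof.
apply: cvg_littleo_ratio.
rewrite (_ : (fun h => _) = tail); first exact: (gcp_no_larger_jump hM).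
by apply/funext => h; rewrite mul0r subr0.
Qed.

Lemma state_prob_le_tail (j : nat) (h : R) : (k < j)%N -> 0 <= h ->
  p j h <= tail h.
Proof.
move=> kj h0; apply: fine_le; rewrite ?fin_num_measure//.
- exact: (gcp_event_measurable [set j] h0).
- exact: (gcp_event_measurable [set i | (k < i)%N] h0).
apply: le_measure; rewrite ?inE.
- exact: (gcp_event_measurable [set j] h0).
- exact: (gcp_event_measurable [set i | (k < i)%N] h0).
- by move=> w /= ->.
Qed.

(** A jump of size [j > k] is covered by the event that [M] exceeds [k], whose
    probability is negligible with respect to [h]. *)
Lemma state_prob_ratio_cvg (j : nat) : (0 < j)%N ->
  p j h / h @[h --> 0^'+] --> (if (j <= k)%N then lambda j else 0).
Proof.
move=> j0; case: leqP => jk.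
  by apply: cvg_littleo_ratio; apply: (gcp_jump hM); rewrite j0.
apply: (@squeeze_cvgr _ _ _ _ (fun=> 0) (fun h => tail h / h)).
- near=> h.
  have h0 : 0 < h by near: h; exact: nbhs_right_gt.
  rewrite divr_ge0 ?state_prob_ge0 ?(ltW h0)//=.
  by rewrite ler_pM2r ?invr_gt0// state_prob_le_tail// ltW.
- exact: cvg_cst.
- exact: tail_ratio_cvg.
Unshelve. all: by end_near. Qed.

Lemma state_prob_total (h : R) : 0 <= h ->
  \sum_(j < k.+1) p j h + tail h = 1.
Proof.
move=> h0.
pose E (j : nat) := M h @^-1` [set j].
have mE j : measurable (E j) by exact: gcp_event_measurable.
have mtail : measurable [set w | (k < M h w)%N].
  exact: (gcp_event_measurable [set i | (k < i)%N] h0).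
have mU : measurable (\big[setU/set0]_(j < k.+1) E j).
  exact: bigsetU_measurable.
have tE : trivIset setT (fun j : 'I_k.+1 => E j).
  by move=> i j _ _ [w [/= wi wj]]; apply/val_inj; rewrite /= -wi -wj.
have := probability_setT P.
have -> : [set: T] = \big[setU/set0]_(j < k.+1) E j `|`
    [set w | (k < M h w)%N].
  apply/seteqP; split=> w // _; rewrite -bigcup_mkord/=.
  case: (ltnP k (M h w)) => Mk; [by right|left].
  by exists (M h w) => //=; rewrite ltnS.
rewrite measureU//; last first.
  apply/seteqP; split=> w //=; rewrite -bigcup_mkord => -[[j /= jk]].
  by rewrite /E/= => ->; rewrite ltnNge -ltnS jk.
rewrite measure_bigsetU_ord//.
move=> /(congr1 fine); rewrite fineD ?fin_num_measure//; last first.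
  by apply/sum_fin_numP => j _ _; exact: fin_num_measure.
by rewrite -sum_fine//= => j _; exact: fin_num_measure.
Qed.

(** No rate is given for staying at 0: the limit follows because all the other
    probabilities vanish at small times and the total mass is 1. *)
Lemma state_prob0_cvg : p 0%N h @[h --> 0^'+] --> (1 : R).
Proof.
have : 1 - (\sum_(j < k) p j.+1 h + tail h) @[h --> 0^'+] -->
    1 - (\sum_(j < k) 0 + 0 : R).
  apply: cvgB; first exact: cvg_cst.
  apply: cvgD; last exact: (cvg_ratio0 tail_ratio_cvg).
  apply: cvg_big => [|j _]; first exact: add_continuous.
  exact: (cvg_ratio0 (state_prob_ratio_cvg _)).
rewrite big1// addr0 subr0; apply: cvg_trans; apply: near_eq_cvg.
near=> h.
have h0 : 0 <= h by near: h; exact: nbhs_right_ge.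
rewrite -(state_prob_total h0) big_ord_recl.
by rewrite -(addrA (p _ h)) addrK.
Unshelve. all: by end_near. Qed.

(** * The recursion *)

(** The limit [m --> oo] of the discrete recursion with step [t / m].  On the
    left the factor [p(n-j, t/m)] tends to 0 unless [j = n]; on the right the
    factor [m] turns [p(j+1, t/m)] into [t] times a difference quotient. *)
Lemma state_prob_recursion_rates (n : nat) (t : R) : 0 < t ->
  n.+1%:R * p n.+1 t =
  t * \sum_(j < n.+1)
        (if (j.+1 <= k)%N then lambda j.+1 else 0) *+ j.+1 * p (n - j)%N t.
Proof.
move=> t0.
pose step (m : nat) := t / m.+1%:R.
have stepK m : m.+1%:R * step m = t by rewrite mulrC divfK// pnatr_eq0.
have stepE m : \sum_(j < n.+1) p j.+1 t *+ j.+1 * p (n - j)%N (step m) =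
    t * \sum_(j < n.+1)
      (p j.+1 (step m) / step m) *+ j.+1 * p (n - j)%N t.
  have step0 : 0 < step m by rewrite divr_gt0.
  have := state_prob_discrete_recursion n m.+1 (ltW step0).
  rewrite stepK => ->.
  have tE x : t * x = (step m * x) *+ m.+1.
    by rewrite -{1}(stepK m) -mulrA mulr_natl.
  rewrite tE; congr (_ *+ _); rewrite mulr_sumr; apply: eq_bigr => j _.
  by rewrite mulrA mulrnAr (mulrC (step m)) divfK// gt_eqF.
have lhs : \sum_(j < n.+1) p j.+1 t *+ j.+1 * p (n - j)%N (step m)
    @[m --> \oo] --> \sum_(j < n.+1) p j.+1 t *+ j.+1 * (n - j == 0)%N%:R.
  apply: cvg_big => [|j _]; first exact: add_continuous.
  apply: cvgMr; apply: (cvg_at_right0_divn t0).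
  case: (n - j)%N => [|i] /=; first exact: state_prob0_cvg.
  exact: (cvg_ratio0 (state_prob_ratio_cvg _)).
have rhs : \sum_(j < n.+1) p j.+1 t *+ j.+1 * p (n - j)%N (step m)
    @[m --> \oo] -->
    t * \sum_(j < n.+1)
      (if (j.+1 <= k)%N then lambda j.+1 else 0) *+ j.+1 * p (n - j)%N t.
  under eq_fun => m do rewrite (stepE m).
  apply: cvgMr; apply: cvg_big => [|j _]; first exact: add_continuous.
  apply: cvgMl; apply: cvgMn.
  exact: (cvg_at_right0_divn t0 (state_prob_ratio_cvg _)).
have -> : n.+1%:R * p n.+1 t =
    \sum_(j < n.+1) p j.+1 t *+ j.+1 * (n - j == 0)%N%:R.
  rewrite big_ord_recr/= subnn eqxx mulr1 mulr_natl big1 ?add0r// => j _.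
  by rewrite subn_eq0 leqNgt ltn_ord mulr0.
exact: (cvg_unique _ lhs rhs).
Qed.

End gcp.

Theorem proposition3p1 (R : realType) (d : measure_display)
    (T : measurableType d) (P : probability T R) (k : nat) (hk : (1 <= k)%N)
    (lambda : nat -> R) (hlambda : forall j, (1 <= j <= k)%N -> 0 < lambda j)
    (M : R -> T -> nat) (hM : GCP P k lambda M) (n : nat) (hn : (1 <= n)%N)
    (t : R) (ht : 0 <= t) :
  state_prob P M n t =
  t / n%:R * \sum_(1 <= j < (minn n k).+1)
                j%:R * lambda j * state_prob P M (n - j)%N t.
Proof.
case: n hn => // n _.
have [->|t_neq0] := eqVneq t 0; first by rewrite (state_prob_start hM) !mul0r.
have t0 : 0 < t by rewrite lt_def t_neq0.
have n0 : n.+1%:R != 0 :> R by rewrite pnatr_eq0.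
apply: (mulfI n0); rewrite (state_prob_recursion_rates hM n t0).
rewrite mulrA mulrCA divff// mulr1; congr (_ * _).
rewrite big_add1/= -(big_mkord xpredT (fun j =>
  (if (j.+1 <= k)%N then lambda j.+1 else 0) *+ j.+1 * state_prob P M (n - j) t)).
(* The rates vanish beyond k, which cuts the sum off at minn n.+1 k. *)
rewrite (big_cat_nat (n := minn n.+1 k))//= ?geq_minl//.
rewrite [X in _ + X]big_nat_cond [X in _ + X]big1 ?addr0; last first.
  move=> j; rewrite andbT geq_min => /andP[+ jn].
  by rewrite leqNgt jn/= => kj; rewrite ltnNge kj/= mul0rn mul0r.
apply: eq_big_nat => j /andP[_]; rewrite leq_min => /andP[_ jk].
by rewrite jk subSS mulr_natl.
Qed.
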